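(* Let $\Omega\subset\mathbb R^2$ be a rectangle with periodic boundary conditions, $\mathcal T_h$ a (finite) conforming Cartesian rectangular mesh of it, and $p\ge 1$ the polynomial degree. Let $t\mapsto (U^K_{ij}(t))_{K\in\mathcal T_h,\,0\le i,j\le p}$ be a solution of the nodal DGSEM system for the 2.5D compressible Euler equations (written out in the context) such that all nodal states have positive density and positive pressure. Then the global Euler variables are conserved: $$\frac{d}{dt}\sum_{K\in\mathcal T_h}\sum_{i,j=0}^p M^K_{ij}U^K_{ij}=0 .$$ If, in addition, the interface flux satisfies Tadmor's inequality at all interface nodes, i.e. for every face node of every face normal to coordinate direction $d\in\{x,y\}$, with traces $U^-,U^+$ ordered in the positive $d$-direction and $V^\pm=V(U^\pm)$, $$(V^+-V^-)^T\widehat F_d(U^-,U^+)-\bigl(\psi_d(U^+)-\psi_d(U^-)\bigr)\le 0 ,$$ then the discrete entropy inequality $$\frac{d}{dt}\sum_{K\in\mathcal T_h}\sum_{i,j=0}^p M^K_{ij}\,\eta(U^K_{ij})\le 0$$ holds.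
   Context: **Euler variables.** $U=(\rho,m_x,m_y,m_z,E)^T\in\mathbb R^5$, $\boldsymbol m=\rho\boldsymbol u$, $\boldsymbol u=(u_x,u_y,u_z)$; pressure $\mathsf p=(\gamma-1)\bigl(E-\tfrac{|\boldsymbol m|^2}{2\rho}\bigr)$ with $\gamma>1$. Fluxes, for $d\in\{x,y\}$: $F_d(U)=(m_d,\ m_xu_d+\delta_{xd}\mathsf p,\ m_yu_d+\delta_{yd}\mathsf p,\ m_zu_d,\ (E+\mathsf p)u_d)^T$. Entropy: $s=\log \mathsf p-\gamma\log\rho$, $\eta=-\rho s/(\gamma-1)$, entropy flux $q_d=\eta u_d$, entropy variables $V=\partial\eta/\partial U$, entropy potentials $\psi_d=V^TF_d-q_d$. **Mesh and nodes.** Each element $K$ is an axis-parallel rectangle with side lengths $h_{x,K},h_{y,K}$, the affine image of $[-1,1]^2$; $J_K=h_{x,K}h_{y,K}/4$. Conforming Cartesian means that neighbouring elements (including periodic neighbours) share entire faces. Let $\xi_i,\omega_i$ ($0\le i\le p$) be the $(p+1)$-point Gauss–Lobatto–Legendre (GLL) nodes and weights on $[-1,1]$ and $\ell_i$ the Lagrange basis. $U^K_{ij}\in\mathbb R^5$ is the nodal state of $K$ at (the image of) $(\xi_i,\xi_j)$, and $M^K_{ij}=J_K\omega_i\omega_j$. Set $D_{ij}=\ell_j'(\xi_i)$, $Q=\mathrm{diag}(\omega_0,\dots,\omega_p)D$. **Two-point volume flux (Chandrashekar).** For two states $L,R$: $\{\!\{a\}\!\}=\frac{a_L+a_R}2$;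 $a^{\log}=\frac{a_R-a_L}{\log a_R-\log a_L}$ ($=a_L$ if $a_L=a_R$); $\beta=\rho/(2\mathsf p)$; $\widehat{\mathsf p}=\frac{\{\!\{\rho\}\!\}}{2\{\!\{\beta\}\!\}}$; $\widehat h=\frac1{2(\gamma-1)\beta^{\log}}-\frac12\{\!\{|\boldsymbol u|^2\}\!\}+|\{\!\{\boldsymbol u\}\!\}|^2+\frac{\widehat{\mathsf p}}{\rho^{\log}}$; $$F_d^{\rm ec}(U_L,U_R)=\begin{pmatrix}\rho^{\log}\{\!\{u_d\}\!\}\\ \rho^{\log}\{\!\{u_x\}\!\}\{\!\{u_d\}\!\}+\delta_{xd}\widehat{\mathsf p}\\ \rho^{\log}\{\!\{u_y\}\!\}\{\!\{u_d\}\!\}+\delta_{yd}\widehat{\mathsf p}\\ \rho^{\log}\{\!\{u_z\}\!\}\{\!\{u_d\}\!\}\\ \rho^{\log}\{\!\{u_d\}\!\}\widehat h\end{pmatrix}.$$ **Interface flux.** Local Lax–Friedrichs: $\widehat F_d(U^-,U^+)=\frac12(F_d(U^-)+F_d(U^+))-\frac12\lambda_d(U^-,U^+)(U^+-U^-)$, $\lambda_d=\max_{\sigma\in\{-,+\}}(|u_d^\sigma|+c^\sigma)$, $c=\sqrt{\gamma \mathsf p/\rho}$. On each face the traces $U^-,U^+$ are the nodal states from the two adjacent elements at the common face node, $U^-$ from the element on the lower-coordinate side and $U^+$ from the other one; on periodic boundaries the exterior trace is taken from the periodic neighbour. **DGSEM system.** On $K$ put $\mathcal F_x=\frac{h_{y,K}}2F_x^{\rm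 ec}$, $\mathcal F_y=\frac{h_{x,K}}2F_y^{\rm ec}$, and $$R^{K,\rm vol}_{ij}=2\sum_{r=0}^pQ_{ir}\omega_j\mathcal F_x(U^K_{ij},U^K_{rj})+2\sum_{s=0}^p\omega_iQ_{js}\mathcal F_y(U^K_{ij},U^K_{is}).$$ At face nodes of $K$ let $\Delta\widetilde F_x=\frac{h_{y,K}}2\bigl(F_x(U^K)-\widehat F_x\bigr)$, $\Delta\widetilde F_y=\frac{h_{x,K}}2\bigl(F_y(U^K)-\widehat F_y\bigr)$, where $U^K$ is the nodal state of $K$ at that face node and $\widehat F_d$ the interface flux there. The system is, for all $K$ and $0\le i,j\le p$, $$M^K_{ij}\frac{dU^K_{ij}}{dt}+R^{K,\rm vol}_{ij}+\omega_i\bigl[(\Delta\widetilde F_y)_{i,0}\delta_{j,0}-(\Delta\widetilde F_y)_{i,p}\delta_{j,p}\bigr]+\omega_j\bigl[(\Delta\widetilde F_x)_{0,j}\delta_{i,0}-(\Delta\widetilde F_x)_{p,j}\delta_{i,p}\bigr]=0 .$$ *)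

(* Defs.v *)
From HB Require Import structures.
From mathcomp Require Import all_boot all_order all_algebra.
From mathcomp Require Import all_classical all_reals all_analysis.

Set Implicit Arguments.
Unset Strict Implicit.
Unset Printing Implicit Defensive.

Import Order.TTheory GRing.Theory Num.Theory.
Import numFieldNormedType.Exports.

Local Open Scope classical_set_scope.
Local Open Scope ring_scope.

Variant direction := dirX | dirY.

Section Euler.
Context {R : realType}.
Variable gamma : R.

(* Conservative state (rho, m_x, m_y, m_z, E); the row numerals below are     *)
(* elements of 'I_5.                                                          *)
Definition state := 'cV[R]_5.

Definition vec5 (a b c d e : R) : state := \col_k nth 0 [:: a; b; c; d; e] k.

Definition dot (V W : state) : R := (V^T *m W) 0 0.

Implicit Types (U L W : state) (d : direction).

Definition density U : R := U 0 0.
Definition mx U : R := U 1 0.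
Definition my U : R := U 2 0.
Definition mz U : R := U 3 0.
Definition energy U : R := U 4 0.

Definition ux U : R := mx U / density U.
Definition uy U : R := my U / density U.
Definition uz U : R := mz U / density U.

Definition vel d U : R := match d with dirX => ux U | dirY => uy U end.
Definition mom d U : R := match d with dirX => mx U | dirY => my U end.

Definition kron d d' : R :=
  match d, d' with dirX, dirX | dirY, dirY => 1 | _, _ => 0 end.

Definition pressure U : R :=
  (gamma - 1) *
  (energy U - (mx U ^+ 2 + my U ^+ 2 + mz U ^+ 2) / (2 * density U)).

Definition flux d U : state :=
  vec5 (mom d U)
       (mx U * vel d U + kron dirX d * pressure U)
       (my U * vel d U + kron dirY d * pressure U)
       (mz U * vel d U)
       ((energy U + pressure U) * vel d U).

Definition spec_entropy U : R := ln (pressure U) - gamma * ln (density U).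

Definition entropy U : R := - (density U * spec_entropy U) / (gamma - 1).

Definition entropy_flux d U : R := entropy U * vel d U.

Definition entropy_var U : state := \col_k 'D_(delta_mx k 0) entropy U.

Definition entropy_pot d U : R :=
  dot (entropy_var U) (flux d U) - entropy_flux d U.

Definition avg (a b : R) : R := (a + b) / 2.

Definition logmean (a b : R) : R :=
  if a == b then a else (b - a) / (ln b - ln a).

Definition beta U : R := density U / (2 * pressure U).

Definition speed2 U : R := ux U ^+ 2 + uy U ^+ 2 + uz U ^+ 2.

(* Chandrashekar's entropy conservative two-point flux. *)
Definition flux_ec d L W : state :=
  let rho_log := logmean (density L) (density W) in
  let beta_log := logmean (beta L) (beta W) in
  let ux_avg := avg (ux L) (ux W) in
  let uy_avg := avg (uy L) (uy W) in
  let uz_avg := avg (uz L) (uz W) in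
  let ud_avg := avg (vel d L) (vel d W) in
  let p_hat := avg (density L) (density W) / (2 * avg (beta L) (beta W)) in
  let h_hat := 1 / (2 * (gamma - 1) * beta_log)
               - 1 / 2 * avg (speed2 L) (speed2 W)
               + (ux_avg ^+ 2 + uy_avg ^+ 2 + uz_avg ^+ 2)
               + p_hat / rho_log in
  vec5 (rho_log * ud_avg)
       (rho_log * ux_avg * ud_avg + kron dirX d * p_hat)
       (rho_log * uy_avg * ud_avg + kron dirY d * p_hat)
       (rho_log * uz_avg * ud_avg)
       (rho_log * ud_avg * h_hat).

Definition sound U : R := Num.sqrt (gamma * pressure U / density U).

Definition wavespeed d L W : R :=
  Num.max (`|vel d L| + sound L) (`|vel d W| + sound W).

Definition flux_llf d L W : state :=
  2^-1 *: (flux d L + flux d W) - (2^-1 * wavespeed d L W) *: (W - L).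

Definition tadmor d L W : Prop :=
  dot (entropy_var W - entropy_var L) (flux_llf d L W)
  - (entropy_pot d W - entropy_pot d L) <= 0.

Definition admissible U : Prop := 0 < density U /\ 0 < pressure U.

End Euler.

Section GaussLobattoLegendre.
Context {R : realType} {p : nat}.

(* Rodrigues' formula. *)
Definition legendre (n : nat) : {poly R} :=
  ((2 ^ n * n`!)%:R)^-1 *: (('X^2 - 1) ^+ n)^`(n).

(* The GLL nodes are the roots of (1 - x^2) P_p'(x). This polynomial has      *)
(* degree p + 1 for p >= 1, so the condition determines xi completely.        *)
Definition gll_nodes (xi : 'I_p.+1 -> R) : Prop :=
  (forall i j : 'I_p.+1, (i < j)%N -> xi i < xi j) /\
  (forall i, root ((1 - 'X^2) * (legendre p)^`()) (xi i)).

Variable xi : 'I_p.+1 -> R.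

Definition lagrange_basis (i : 'I_p.+1) : {poly R} :=
  \prod_(k < p.+1 | k != i) ((xi i - xi k)^-1 *: ('X - (xi k)%:P)).

(* Weights of the interpolatory quadrature rule on the nodes xi. *)
Definition weight (i : 'I_p.+1) : R :=
  \int[lebesgue_measure]_(x in `[-1, 1]) (lagrange_basis i).[x].

Definition Dmat : 'M[R]_p.+1 := \matrix_(i, j) ((lagrange_basis j)^`()).[xi i].

Definition Qmat : 'M[R]_p.+1 := diag_mx (\row_i weight i) *m Dmat.

End GaussLobattoLegendre.

(* An element ending at coordinate x abuts one starting at y, the endpoints a  *)
(* and b of the domain being identified by periodicity.                       *)
Definition glued (R : realType) (a b x y : R) : Prop :=
  x = y \/ (x = b /\ y = a).

(* Finite conforming mesh of the periodic rectangle                           *)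
(* [xmin, xmax] x [ymin, ymax]: the elements are nondegenerate rectangles     *)
(* [xlo K, xhi K] x [ylo K, yhi K] that tile it, and across each of its four  *)
(* faces every element has a neighbour (possibly itself, by periodicity) with *)
(* which it shares that entire face. As interiors are disjoint, the geometry  *)
(* determines the four neighbour maps, and east/west and north/south are      *)
(* mutually inverse.                                                          *)
Record mesh (R : realType) := Mesh {
  elt :> finType;
  xmin : R; xmax : R; ymin : R; ymax : R;
  xlo : elt -> R; xhi : elt -> R; ylo : elt -> R; yhi : elt -> R;
  west : elt -> elt; east : elt -> elt;
  south : elt -> elt; north : elt -> elt;
  domain_nondeg : xmin < xmax /\ ymin < ymax;
  elt_nondeg : forall K, xlo K < xhi K /\ ylo K < yhi K;
  elt_cover :
    \bigcup_(K in [set: elt]) (`[xlo K, xhi K] `*` `[ylo K, yhi K])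
    = `[xmin, xmax] `*` `[ymin, ymax];
  elt_disjoint : forall K L, K != L ->
    (`]xlo K, xhi K[ `*` `]ylo K, yhi K[) `&`
    (`]xlo L, xhi L[ `*` `]ylo L, yhi L[) = set0;
  east_conforming : forall K, [/\ glued xmin xmax (xhi K) (xlo (east K)),
    ylo (east K) = ylo K & yhi (east K) = yhi K];
  west_conforming : forall K, [/\ glued xmin xmax (xhi (west K)) (xlo K),
    ylo (west K) = ylo K & yhi (west K) = yhi K];
  north_conforming : forall K, [/\ glued ymin ymax (yhi K) (ylo (north K)),
    xlo (north K) = xlo K & xhi (north K) = xhi K];
  south_conforming : forall K, [/\ glued ymin ymax (yhi (south K)) (ylo K),
    xlo (south K) = xlo K & xhi (south K) = xhi K]
}.

Section DGSEM.
Context {R : realType} {p : nat} {T : mesh R}.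
Variables (gamma : R) (xi : 'I_p.+1 -> R).

Definition nodal_states := T -> 'I_p.+1 -> 'I_p.+1 -> @state R.

Implicit Types (U : nodal_states) (K : T) (i j : 'I_p.+1).

Local Notation w := (weight xi).
Local Notation Q := (Qmat xi).

Definition hx K : R := xhi K - xlo K.
Definition hy K : R := yhi K - ylo K.

Definition mass K i j : R := hx K * hy K / 4 * w i * w j.

Definition vol_flux_x K L W : state := (hy K / 2) *: flux_ec gamma dirX L W.
Definition vol_flux_y K L W : state := (hx K / 2) *: flux_ec gamma dirY L W.

Definition vol_residual U K i j : state :=
  2 *: \sum_(r < p.+1) (Q i r * w j) *: vol_flux_x K (U K i j) (U K r j)
  + 2 *: \sum_(s < p.+1) (w i * Q j s) *: vol_flux_y K (U K i j) (U K i s).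

(* Interface flux at node j of the east face of K, resp. at node i of its     *)
(* north face; every face of the periodic mesh is the east or the north face  *)
(* of exactly one element, the one on its lower-coordinate side.              *)
Definition iflux_x U K j : state :=
  flux_llf gamma dirX (U K ord_max j) (U (east K) ord0 j).
Definition iflux_y U K i : state :=
  flux_llf gamma dirY (U K i ord_max) (U (north K) i ord0).

Definition dF_west U K j : state :=
  (hy K / 2) *: (flux gamma dirX (U K ord0 j) - iflux_x U (west K) j).
Definition dF_east U K j : state :=
  (hy K / 2) *: (flux gamma dirX (U K ord_max j) - iflux_x U K j).
Definition dF_south U K i : state :=
  (hx K / 2) *: (flux gamma dirY (U K i ord0) - iflux_y U (south K) i).
Definition dF_north U K i : state :=
  (hx K / 2) *: (flux gamma dirY (U K i ord_max) - iflux_y U K i).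

Definition surf_residual U K i j : state :=
  w i *: ((j == ord0)%:R *: dF_south U K i - (j == ord_max)%:R *: dF_north U K i)
  + w j *: ((i == ord0)%:R *: dF_west U K j - (i == ord_max)%:R *: dF_east U K j).

Definition dgsem_solution (I : set R) (U : R -> nodal_states) : Prop :=
  forall t, I t -> forall K i j,
    derivable (fun s => U s K i j) t 1 /\
    mass K i j *: derive1 (fun s => U s K i j) t
    + vol_residual (U t) K i j + surf_residual (U t) K i j = 0.

Definition tadmor_at_interfaces U : Prop :=
  (forall K j, tadmor gamma dirX (U K ord_max j) (U (east K) ord0 j)) /\
  (forall K i, tadmor gamma dirY (U K i ord_max) (U (north K) i ord0)).

Definition total_state U : state :=
  \sum_(K : T) \sum_(i < p.+1) \sum_(j < p.+1) mass K i j *: U K i j.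

Definition total_entropy U : R :=
  \sum_(K : T) \sum_(i < p.+1) \sum_(j < p.+1)
    mass K i j * entropy gamma (U K i j).

End DGSEM.

(* Main.v *)
(* Test the scheme with a nodal field v and let psi be a potential whose      *)
(* two-point differences along grid lines are (v_i - v_r)^T F^ec(U_i, U_r).   *)
(* On a grid line, split v_i into its mean with v_r, which leaves a symmetric *)
(* two-point function, and half the difference v_i - v_r, which turns into    *)
(* potentials. The summation-by-parts property Q + Q^T = diag(-1,0,..,0,1),   *)
(* i.e. exactness of the Gauss-Lobatto rule up to degree 2p - 1, reduces both *)
(* to boundary values; the surface terms replace the physical flux by the     *)
(* interface flux, and regrouping by faces leaves minus the weighted sum of   *)
(* the jumps [v]^T F^ - [psi]. A constant v with psi = 0 gives conservation;  *)
(* v = V with the entropy potentials gives the entropy inequality, since the  *)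
(* two-point flux satisfies Tadmor's identity and the weights are             *)
(* nonnegative.                                                               *)

From HB Require Import structures.
Require Import Defs.
From mathcomp Require Import all_boot all_order all_algebra.
From mathcomp Require Import all_classical all_reals all_analysis.
From mathcomp Require Import ring lra zify.
Import Order.TTheory GRing.Theory Num.Theory.
Import numFieldNormedType.Exports.
Local Open Scope classical_set_scope.
Local Open Scope ring_scope.
Set Implicit Arguments.
Unset Strict Implicit.
Unset Printing Implicit Defensive.

(** * Polynomials and their integrals over [-1, 1] *)

Section PolynomialIntegral.
Context {R : realType}.
Implicit Types f g : {poly R}.

(** Both claims are the two choices of test field in one identity, [global_balance], for the
    residual tested against a nodal field. Three facts feed it. On the quadrature side, [gll_exact]
    makes the entries of [Qmat] exact integrals, whence [sum_by_parts], [Qmat_row_sum] and, with a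
    partly squared Lagrange polynomial, [weight_ge0]. On the Euler side, [flux_ec_tadmor] is
    Tadmor's two-point equality, and [is_derive_entropy] is the chain rule that turns the entropy
    rate into the scheme tested with the entropy variables. On the mesh side, [eastK] and [northK]
    say that each face is seen exactly once from each side. [line_balance] joins the first two on a
    single grid line; summing over lines and faces leaves only interface jumps, which cancel for a
    constant field and have a sign under Tadmor's inequality. *)

Definition primitive f : {poly R} := \poly_(i < (size f).+1) (f`_i.-1 / i%:R).

(** Valid for every index: at 0 the division by zero yields 0, so the constant term vanishes, and
    beyond the size the coefficients of [f] are 0. *)
Lemma coef_primitive f i : (primitive f)`_i = f`_i.-1 / i%:R.
Proof.
rewrite coef_poly; case: ltnP => // szf.
by case: i szf => [//|i szf]; rewrite /= nth_default ?mul0r.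
Qed.

Lemma deriv_primitive f : (primitive f)^`() = f.
Proof.
apply/polyP => i; rewrite coef_deriv coef_primitive /= -[LHS]mulr_natr mulfVK //.
Qed.

Definition pint f : R := (primitive f).[1] - (primitive f).[-1].

Lemma pint_is_linear : linear (pint : {poly R} -> R^o).
Proof.
move=> a f g; rewrite /pint.
have -> : primitive (a *: f + g) = a *: primitive f + primitive g.
  apply/polyP => i; rewrite coefD coefZ !coef_primitive coefD coefZ.
  by rewrite mulrDl mulrA.
by rewrite !hornerE /GRing.scale /=; ring.
Qed.

HB.instance Definition _ :=
  GRing.isLinear.Build R {poly R} R^o _ pint pint_is_linear.

Lemma pint_deriv f : pint f^`() = f.[1] - f.[-1].
Proof.
have -> : f = primitive f^`() + (f`_0)%:P.
  apply/polyP => i; rewrite coefD coef_primitive coefC coef_deriv.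
  case: i => [|i] /=; first by rewrite invr0 mulr0 add0r.
  by rewrite addr0 -[X in X / _]mulr_natr mulfK // pnatr_eq0.
rewrite !hornerE derivD deriv_primitive derivC addr0 /pint; ring.
Qed.

Lemma pint_by_parts f g :
  pint (f * g^`()) = (f * g).[1] - (f * g).[-1] - pint (f^`() * g).
Proof. by rewrite -pint_deriv derivM linearD /= addrAC subrr add0r. Qed.

Lemma pintE f : pint f = \int[lebesgue_measure]_(x in `[-1, 1]) f.[x].
Proof.
rewrite /Rintegral (@continuous_FTC2 _ (horner f) (horner (primitive f))) //.
- exact/continuous_subspaceT/continuous_horner.
- split=> [x _||]; first exact: derivable_horner.
  + exact/cvg_at_right_filter/continuous_horner.
  + exact/cvg_at_left_filter/continuous_horner.
- by move=> x _; rewrite -derivE deriv_primitive.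
Qed.

Lemma pint_ge0 f : (forall x, -1 <= x <= 1 -> 0 <= f.[x]) -> 0 <= pint f.
Proof.
move=> f_ge0; rewrite pintE; apply: Rintegral_ge0 => x /=.
by rewrite in_itv /=; exact: f_ge0.
Qed.

End PolynomialIntegral.

Section PolynomialDerivatives.
Context {R : realType}.
Implicit Types (f g : {poly R}) (a x : R).

(** In characteristic zero the leading coefficient is multiplied by a nonzero integer, so each
    derivative lowers the degree by exactly one. *)
Lemma size_derivn f n : size f^`(n) = (size f - n)%N.
Proof.
elim: n => [|n IH]; first by rewrite subn0.
rewrite derivnS subnS -IH; set g := f^`(n).
have [->|g_neq0] := eqVneq g 0; first by rewrite deriv0 size_poly0.
apply/eqP; rewrite eqn_leq -ltnS prednK ?size_poly_gt0 // lt_size_deriv //=.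
have [->//|sg] := posnP (size g).-1.
rewrite -(prednK sg) ltnNge; apply/negP => /leq_sizeP/(_ _ (leqnn _))/eqP.
rewrite coef_deriv prednK // mulrn_eq0 -lead_coefE lead_coef_eq0.
by rewrite (negPf g_neq0) orbF -leqn0 leqNgt sg.
Qed.

Lemma dvdp_exp_deriv a n f :
  ('X - a%:P) ^+ n.+1 %| f -> ('X - a%:P) ^+ n %| f^`().
Proof.
case/dvdpP => g ->; rewrite derivM deriv_exp derivXsubC mul1r /=.
apply: dvdp_add; first by rewrite exprS mulrA dvdp_mull.
by rewrite mulrnAr -mulrnAl dvdp_mull.
Qed.

(** Each derivative lowers the multiplicity of a root by at most one. *)
Lemma root_derivn a n k f :
  ('X - a%:P) ^+ n %| f -> (k < n)%N -> root f^`(k) a.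
Proof.
move=> dvd_f lt_kn; suff: ('X - a%:P) ^+ (n - k) %| f^`(k).
  move=> dvd; rewrite -dvdp_XsubCl; apply: dvdp_trans dvd.
  by rewrite -(subnSK lt_kn) exprS dvdp_mulr.
elim: k lt_kn => [|k IH] lt_kn; first by rewrite subn0.
rewrite derivnS; apply: dvdp_exp_deriv; rewrite subnSK; last exact: ltnW.
exact/IH/ltnW.
Qed.

Lemma derivn_comp_linear f a b n :
  (f \Po (a *: 'X + b%:P))^`(n) = a ^+ n *: (f^`(n) \Po (a *: 'X + b%:P)).
Proof.
elim: n => [|n IH]; first by rewrite expr0 scale1r.
rewrite derivnS IH derivZ deriv_comp derivD derivZ derivX derivC addr0.
by rewrite alg_polyC mulrC mul_polyC scalerA derivnS exprSr.
Qed.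

Lemma nneg_poly_gt0 f x :
  f \is a polyOver Num.nneg -> f != 0 -> 0 < x -> 0 < f.[x].
Proof.
move=> /polyOverP f_ge0 f_neq0 x_gt0; rewrite horner_coef.
have sf : (0 < size f)%N by rewrite size_poly_gt0.
have lt_sf : ((size f).-1 < size f)%N by rewrite ltn_predL.
rewrite (bigD1 (Ordinal lt_sf)) //= ltr_wpDr //.
  apply: sumr_ge0 => i _; apply: mulr_ge0; last exact/exprn_ge0/ltW.
  exact: f_ge0.
rewrite mulr_gt0 ?exprn_gt0 // lt_def.
by rewrite -lead_coefE lead_coef_eq0 f_neq0 lead_coefE; exact: f_ge0.
Qed.

End PolynomialDerivatives.

(** * Legendre polynomials *)

Section LegendrePolynomials.
Context {R : realType}.
Implicit Types (f q : {poly R}) (x e : R).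

Local Notation rodrigues p := (('X^2 - 1 : {poly R}) ^+ p).

Lemma size_rodrigues p : size (rodrigues p) = (2 * p).+1.
Proof.
have W0 : rodrigues p != 0 by rewrite expf_neq0 // -size_poly_gt0 size_Xn_sub_1.
by rewrite -[LHS]prednK ?size_poly_gt0 // size_exp size_Xn_sub_1.
Qed.

Lemma dvdp_rodrigues p e : e ^+ 2 = 1 -> ('X - e%:P) ^+ p %| rodrigues p.
Proof.
by move=> e2; rewrite dvdp_exp2r // dvdp_XsubCl /root !hornerE e2 subrr.
Qed.

(* Writing x = e (y + 1) with e = 1 or -1 and y > 0 turns x^2 - 1 into        *)
(* y (y + 2), all of whose powers and derivatives have nonnegative            *)
(* coefficients.                                                              *)
Lemma rodrigues_derivn_neq0 p k e y : e ^+ 2 = 1 -> 0 < y -> (k <= 2 * p)%N ->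
  ~~ root (rodrigues p)^`(k) (e * y + e).
Proof.
move=> e2 y_gt0 le_k2p; set W := rodrigues p.
have Wcomp : W \Po (e *: 'X + e%:P) = ('X^2 + 2%:P * 'X) ^+ p.
  rewrite rmorphXn /= rmorphB /= rmorphXn /= comp_polyX rmorph1; congr (_ ^+ p).
  rewrite sqrrD exprZn e2 scale1r -polyC_exp e2 polyC1 -mul_polyC mulrAC.
  by rewrite -polyCM -expr2 e2 polyC1 addrK mul1r -mulr_natl polyC_natr.
have := derivn_comp_linear W e e k; rewrite Wcomp => /(congr1 (horner^~ y)).
rewrite hornerZ horner_comp !hornerE => Wk.
apply/negP => /rootP rootW; move: Wk; rewrite rootW mulr0 => /eqP.
apply/negP/lt0r_neq0/nneg_poly_gt0 => //.
  apply/polyOver_derivn/rpredX/rpredD; first exact/rpredX/polyOverX.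
  by rewrite rpredM ?polyOverX // polyOverC nnegrE.
rewrite -size_poly_gt0 size_derivn subn_gt0 -Wcomp size_comp_poly2.
  by rewrite size_rodrigues ltnS.
have e_neq0 : e != 0 by rewrite -sqrf_eq0 e2 oner_eq0.
rewrite size_polyDl !size_scale ?size_polyX //.
exact: leq_ltn_trans (size_polyC_leq1 _) _.
Qed.

(** Any point outside the interval has the form [e * y + e] with [e] an endpoint and [y] positive.
    With [k] equal to [p.+1] this locates the roots of the derivative of [legendre p]. *)
Lemma root_rodrigues_derivn p k x : (k <= 2 * p)%N ->
  root (rodrigues p)^`(k) x -> -1 <= x <= 1.
Proof.
move=> le_k2p root_x; apply/andP; split; rewrite leNgt; apply/negP => x_out.
- have : ~~ root (rodrigues p)^`(k) (-1 * (- x - 1) + -1).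
    by apply: rodrigues_derivn_neq0 => //; [rewrite sqrrN expr1n|lra].
  by rewrite (_ : _ + -1 = x) ?root_x //; ring.
- have : ~~ root (rodrigues p)^`(k) (1 * (x - 1) + 1).
    by apply: rodrigues_derivn_neq0 => //; [rewrite expr1n|lra].
  by rewrite (_ : _ + 1 = x) ?root_x //; ring.
Qed.

(** Integrate by parts [k] times: the endpoints are roots of order [p] of the Rodrigues polynomial,
    so no boundary term appears, and [k] derivatives annihilate [f]. *)
Lemma pint_rodrigues p k f : (k <= p)%N -> (size f <= k)%N ->
  pint (f * (rodrigues p)^`(k)) = 0.
Proof.
elim: k f => [|k IH] f le_kp szf.
  by move: szf; rewrite leqn0 size_poly_eq0 => /eqP->; rewrite mul0r linear0.
have rootW e : e ^+ 2 = 1 -> (rodrigues p)^`(k).[e] = 0.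
  by move=> e2; apply/rootP/(root_derivn (dvdp_rodrigues p e2)).
rewrite derivnS pint_by_parts !hornerM !rootW ?sqrrN ?expr1n //.
rewrite !mulr0 subrr sub0r IH ?oppr0 //; first exact: ltnW.
by rewrite -[f^`()]derivn1 size_derivn leq_subLR add1n.
Qed.

Lemma legendreE p : exists2 c : R, c != 0 & legendre p = c *: (rodrigues p)^`(p).
Proof.
exists ((2 ^ p * p`!)%:R)^-1; last by [].
by rewrite invr_neq0 // pnatr_eq0 muln_eq0 negb_or expn_eq0 -lt0n fact_gt0.
Qed.

Lemma pint_legendre p f : (size f <= p)%N -> pint (f * legendre p) = 0.
Proof.
move=> szf; have [c _ ->] := legendreE p.
by rewrite -scalerAr linearZ /= pint_rodrigues // scaler0.
Qed.

Definition lobatto p : {poly R} := (1 - 'X^2) * (legendre p)^`().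

Lemma size_lobatto p : (0 < p)%N -> size (lobatto p) = p.+2.
Proof.
move=> p_gt0; have [c c_neq0 Ep] := legendreE p.
have szP : size (legendre p : {poly R})^`() = p.
  rewrite -derivn1 size_derivn Ep size_scale // size_derivn size_rodrigues.
  by rewrite mul2n -addnn; lia.
have sz1 : size (1 - 'X^2 : {poly R}) = 3%N.
  by rewrite -opprB size_polyN size_Xn_sub_1.
rewrite size_mul ?sz1 ?szP //.
  by rewrite -size_poly_gt0 sz1.
by rewrite -size_poly_gt0 szP.
Qed.

Lemma root_lobatto p x : (0 < p)%N -> root (lobatto p) x -> -1 <= x <= 1.
Proof.
move=> p_gt0; rewrite rootM => /orP[|].
  rewrite /root !hornerE subr_eq0 eq_sym sqrf_eq1 => /orP[]/eqP->; lra.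
have [c c_neq0 ->] := legendreE p; rewrite derivZ rootZ // -derivnS.
by apply: root_rodrigues_derivn; lia.
Qed.

(** One integration by parts, without boundary terms since [1 - 'X^2] vanishes at the endpoints,
    leaves the derivative of [q * (1 - 'X^2)]. Its degree is below [p], so it is orthogonal to the
    Legendre polynomial. *)
Lemma pint_lobatto p q : (size q < p)%N -> pint (q * lobatto p) = 0.
Proof.
move=> szq; have root_e (e : R) : e ^+ 2 = 1 -> (1 - 'X^2 : {poly R}).[e] = 0.
  by move=> e2; rewrite !hornerE e2 subrr.
rewrite mulrA pint_by_parts !hornerM !root_e ?sqrrN ?expr1n //.
rewrite !(mulr0, mul0r) subrr sub0r.
rewrite pint_legendre ?oppr0 // -derivn1 size_derivn leq_subLR add1n.
apply: leq_trans (size_polyMleq _ _) _.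
by rewrite -opprB size_polyN size_Xn_sub_1 // addn3.
Qed.

End LegendrePolynomials.

(** * Gauss-Lobatto-Legendre quadrature and summation by parts *)

Lemma size_prod_linear (R : idomainType) (I : finType) (P : pred I)
    (F : I -> {poly R}) :
  (forall i, P i -> (size (F i) <= 2)%N) ->
  (size (\prod_(i | P i) F i)%R <= #|P|.+1)%N.
Proof.
move=> szF; apply: leq_trans (size_poly_prod_leq _ _) _.
rewrite leq_subLR addnS ltnS addnn -mul2n mulnC -sum_nat_const.
exact: leq_sum.
Qed.

Section Quadrature.
Context {R : realType} {p : nat}.
Variable xi : 'I_p.+1 -> R.
Hypotheses (p_gt0 : (0 < p)%N) (xi_gll : gll_nodes xi).
Implicit Types (i j k e : 'I_p.+1) (f g : {poly R}) (x : R).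

Lemma gll_inj : injective xi.
Proof.
move=> i j Eij; case: (ltngtP i j) => [||/val_inj//] /xi_gll.1;
by rewrite Eij ltxx.
Qed.

Lemma gll_bound i : -1 <= xi i <= 1.
Proof. exact: root_lobatto p_gt0 (xi_gll.2 i). Qed.

Lemma gll_mono i j : (i <= j)%N -> xi i <= xi j.
Proof.
by rewrite leq_eqVlt => /orP[/eqP/val_inj->//|/xi_gll.1/ltW].
Qed.

(** The [p.+1] distinct nodes already exhaust the roots of a polynomial of degree [p.+1]. This is
    what makes the endpoints nodes. *)
Lemma root_lobatto_gll x : root (lobatto p) x -> x \in codom xi.
Proof.
move=> root_x; apply/negPn/negP => xNxi.
have : all (root (lobatto p)) (x :: codom xi).
  by rewrite /= root_x; apply/allP => _ /codomP[i ->]; exact: xi_gll.2.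
move=> /max_poly_roots; rewrite -size_poly_gt0 size_lobatto //=.
rewrite xNxi size_codom card_ord ltnn map_inj_uniq; last exact: gll_inj.
by rewrite enum_uniq => /(_ isT isT).
Qed.

Lemma gll_first : xi ord0 = -1.
Proof.
have [|i xiE] := codomP (@root_lobatto_gll (-1) _).
  by rewrite rootM /root !hornerE sqrrN expr1n subrr eqxx.
apply/eqP; rewrite eq_le {1}xiE gll_mono //.
by have /andP[] := gll_bound ord0.
Qed.

Lemma gll_last : xi ord_max = 1.
Proof.
have [|i xiE] := codomP (@root_lobatto_gll 1 _).
  by rewrite rootM /root !hornerE expr1n subrr eqxx.
apply/eqP; rewrite eq_le {2}xiE gll_mono ?leq_ord // andbT.
by have /andP[] := gll_bound ord_max.
Qed.

Local Notation lin i k := ((xi i - xi k)^-1 *: ('X - (xi k)%:P)).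

Lemma size_lin i k : (size (lin i k) <= 2)%N.
Proof. by rewrite (leq_trans (size_scale_leq _ _)) ?size_XsubC. Qed.

Lemma horner_lin i k x : (lin i k).[x] = (x - xi k) / (xi i - xi k).
Proof. by rewrite !hornerE mulrC. Qed.

Lemma size_lagrange_basis i : (size (lagrange_basis xi i) <= p.+1)%N.
Proof.
apply: leq_trans (size_prod_linear _) _ => [k _|]; first exact: size_lin.
by have := cardC1 i; rewrite card_ord ltnS => ->.
Qed.

Lemma lagrange_basis_node i j : (lagrange_basis xi i).[xi j] = (i == j)%:R.
Proof.
rewrite horner_prod; have [<-|neq_ij] := eqVneq i j.
  apply: big1 => k neq_ki; rewrite horner_lin divff // subr_eq0.
  by rewrite (inj_eq gll_inj) eq_sym.
by rewrite (bigD1 j) 1?eq_sym //= horner_lin subrr mul0r mul0r.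
Qed.

Lemma poly_nodes_eq f g : (size f <= p.+1)%N -> (size g <= p.+1)%N ->
  (forall i, f.[xi i] = g.[xi i]) -> f = g.
Proof.
move=> szf szg Efg; apply/eqP; rewrite -subr_eq0; apply/eqP.
apply: (@roots_geq_poly_eq0 _ _ (codom xi)).
- by apply/allP => _ /codomP[i ->]; rewrite /root !hornerE Efg subrr.
- by rewrite map_inj_uniq ?enum_uniq //; exact: gll_inj.
- rewrite size_codom card_ord; apply: leq_trans (size_polyD _ _) _.
  by rewrite geq_max szf size_polyN.
Qed.

Lemma lagrange_interpolation f : (size f <= p.+1)%N ->
  f = \sum_i f.[xi i] *: lagrange_basis xi i.
Proof.
move=> szf; apply: poly_nodes_eq => // [|j].
  apply: leq_trans (size_sum _ _ _) _; apply/bigmax_leqP => i _.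
  by rewrite (leq_trans (size_scale_leq _ _)) ?size_lagrange_basis.
rewrite horner_sum (bigD1 j) //= hornerZ lagrange_basis_node eqxx mulr1.
rewrite big1 ?addr0 // => i neq_ij.
by rewrite hornerZ lagrange_basis_node (negPf neq_ij) mulr0.
Qed.

Lemma sum_lagrange_basis : \sum_i lagrange_basis xi i = 1.
Proof.
rewrite [RHS]lagrange_interpolation ?size_poly1 //.
by apply: eq_bigr => i _; rewrite hornerC scale1r.
Qed.

(** Divide by [lobatto p]: the quotient has degree at most [p - 2], so its product with the divisor
    integrates to 0; the remainder has the same nodal values as [f] and equals its interpolant. *)
Lemma gll_exact f : (size f <= 2 * p)%N ->
  pint f = \sum_i weight xi i * f.[xi i].
Proof.
move=> szf; pose N : {poly R} := lobatto p.
have N_neq0 : N != 0 by rewrite -size_poly_gt0 size_lobatto.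
have mod_xi i : (f %% N).[xi i] = f.[xi i].
  rewrite [in RHS](divp_eq f N) hornerD hornerM.
  by rewrite (rootP (xi_gll.2 i)) mulr0 add0r.
rewrite {1}(divp_eq f N) linearD /= pint_lobatto ?add0r; last first.
  by rewrite size_divp // size_lobatto //=; move: (size f) szf => n; lia.
rewrite [f %% N]lagrange_interpolation; last first.
  by rewrite -ltnS -(size_lobatto (R := R) p_gt0) ltn_modp.
rewrite linear_sum; apply: eq_bigr => i _.
by rewrite linearZ /= mod_xi pintE mulrC.
Qed.

(** The square of a Lagrange polynomial has degree [2 * p], one too many for exactness. So one
    linear factor is left unsquared, the one of an endpoint node [e] other than [i], whose sign on
    the interval is known. *)
Lemma weight_ge0 i : 0 <= weight xi i.
Proof.
have [e neq_ei e_end] : exists2 e, e != i &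
    forall x, -1 <= x <= 1 -> 0 <= (x - xi e) / (xi i - xi e).
  have [->|neq_i0] := eqVneq i ord0.
    exists ord_max => [|x x_itv]; first by rewrite -val_eqE -lt0n.
    rewrite gll_first gll_last -mulrNN -invrN.
    by apply: mulr_ge0; [|rewrite invr_ge0]; lra.
  exists ord0 => [|x x_itv]; first by rewrite eq_sym.
  have := gll_bound i; rewrite gll_first => xi_itv.
  by apply: mulr_ge0; [|rewrite invr_ge0]; lra.
pose g := \prod_(k | (k != i) && (k != e)) lin i k.
have lagE : lagrange_basis xi i = lin i e * g.
  by rewrite /lagrange_basis (bigD1 e).
have szg : (size g <= p)%N.
  apply: leq_trans (size_prod_linear _) _ => [k _|]; first exact: size_lin.
  rewrite -(eq_card (_ : [predD1 predC1 i & e] =i _)); last first.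
    by move=> k; rewrite !inE andbC.
  have cardi : #|predC1 i| = p by rewrite cardC1 card_ord.
  by have := cardD1 e (predC1 i); rewrite cardi inE /= neq_ei add1n => <-.
have gi : g.[xi i] = 1.
  rewrite horner_prod big1 // => k /andP[neq_ki _].
  by rewrite horner_lin divff // subr_eq0 (inj_eq gll_inj) eq_sym.
suff <- : pint (lagrange_basis xi i * g) = weight xi i.
  apply: pint_ge0 => x x_itv; rewrite lagE -mulrA hornerM horner_lin.
  by apply: mulr_ge0; [exact: e_end|rewrite hornerM -expr2 sqr_ge0].
rewrite gll_exact; last first.
  apply: leq_trans (size_polyMleq _ _) _.
  move: (size_lagrange_basis i) szg.
  by move: (size (lagrange_basis xi i)) (size g) => m n; lia.
rewrite (bigD1 i) //= hornerM lagrange_basis_node eqxx gi !mulr1.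
rewrite big1 ?addr0 // => k neq_ki.
by rewrite hornerM lagrange_basis_node eq_sym (negPf neq_ki) mul0r mulr0.
Qed.

(** The integrand has degree at most [2 * p - 1], where the quadrature is exact, and only node [i]
    contributes to the quadrature sum. *)
Lemma QmatE i j :
  Qmat xi i j = pint (lagrange_basis xi i * (lagrange_basis xi j)^`()).
Proof.
rewrite gll_exact; last first.
  apply: leq_trans (size_polyMleq _ _) _.
  rewrite -[_^`()]derivn1 size_derivn.
  move: (size_lagrange_basis i) (size_lagrange_basis j).
  by move: (size (lagrange_basis xi i)) (size (lagrange_basis xi j)) => m n; lia.
rewrite /Qmat mul_diag_mx !mxE (bigD1 i) //= hornerM lagrange_basis_node eqxx mul1r.
rewrite big1 ?addr0 // => k neq_ki.
by rewrite hornerM lagrange_basis_node eq_sym (negPf neq_ki) mul0r mulr0.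
Qed.

Lemma sum_by_parts i j : Qmat xi i j + Qmat xi j i =
  (i == ord_max)%:R * (j == ord_max)%:R - (i == ord0)%:R * (j == ord0)%:R.
Proof.
rewrite !QmatE pint_by_parts [lagrange_basis xi j * _]mulrC subrK !hornerM.
by rewrite -!lagrange_basis_node gll_first gll_last.
Qed.

(** The Lagrange basis sums to 1, whose derivative is 0. *)
Lemma Qmat_row_sum i : \sum_j Qmat xi i j = 0.
Proof.
under eq_bigr do rewrite QmatE.
rewrite -linear_sum -mulr_sumr -[\sum_(_ < _) _](linear_sum deriv).
by rewrite sum_lagrange_basis /= -polyC1 derivC mulr0 linear0.
Qed.

End Quadrature.

(** * Entropy variables and the entropy conservative flux *)

Section StateProduct.
Context {R : realType}.
Implicit Types U V W : @state R.

Lemma sum_ord5 (F : 'I_5 -> R) : \sum_k F k = F 0 + F 1 + F 2 + F 3 + F 4.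
Proof.
rewrite !big_ord_recl big_ord0 addr0 !addrA.
by congr (_ + F _ + F _ + F _ + F _); apply/val_inj.
Qed.

Lemma dotE V W : dot V W = \sum_k V k 0 * W k 0.
Proof. by rewrite /dot mxE; apply: eq_bigr => k _; rewrite mxE. Qed.

Lemma dot_vec5 V (a b c d e : R) : dot V (vec5 a b c d e) =
  V 0 0 * a + V 1 0 * b + V 2 0 * c + V 3 0 * d + V 4 0 * e.
Proof. by rewrite dotE sum_ord5 !mxE. Qed.

Lemma vec5E (a b c d e : R) :
  (vec5 a b c d e 0 0 = a) * (vec5 a b c d e 1 0 = b) *
  (vec5 a b c d e 2 0 = c) * (vec5 a b c d e 3 0 = d) *
  (vec5 a b c d e 4 0 = e).
Proof. by rewrite !mxE. Qed.

Lemma dotDr V U W : dot V (U + W) = dot V U + dot V W.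
Proof. by rewrite /dot mulmxDr mxE. Qed.

Lemma dotZr V a W : dot V (a *: W) = a * dot V W.
Proof. by rewrite /dot -scalemxAr mxE. Qed.

Lemma dotDl V U W : dot (V + U) W = dot V W + dot U W.
Proof. by rewrite /dot linearD mulmxDl mxE. Qed.

Lemma dotBl V U W : dot (V - U) W = dot V W - dot U W.
Proof. by rewrite /dot linearB mulmxBl !mxE. Qed.

Lemma dotBr V U W : dot V (U - W) = dot V U - dot V W.
Proof. by rewrite /dot mulmxBr !mxE. Qed.

Lemma dot_sumr (I : Type) (r : seq I) (P : pred I) V (F : I -> state) :
  dot V (\sum_(i <- r | P i) F i) = \sum_(i <- r | P i) dot V (F i).
Proof. by rewrite /dot mulmx_sumr summxE. Qed.

Lemma dotNr V W : dot V (- W) = - dot V W.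
Proof. by rewrite /dot mulmxN mxE. Qed.

Lemma dot_delta (k : 'I_5) W : dot (delta_mx k 0) W = W k 0.
Proof. by rewrite /dot trmx_delta -rowE mxE. Qed.

End StateProduct.

Section EulerEntropy.
Context {R : realType}.
Variable gamma : R.
Hypothesis gamma_gt1 : 1 < gamma.
Implicit Types (U L W V : @state R) (d : direction) (a b : R).

Definition euler_entropy_var U : state :=
  vec5 ((gamma - spec_entropy gamma U) / (gamma - 1) - beta gamma U * speed2 U)
       (2 * beta gamma U * ux U) (2 * beta gamma U * uy U)
       (2 * beta gamma U * uz U) (- (2 * beta gamma U)).

(** The chain rule along an arbitrary curve serves twice: coordinate lines identify [entropy_var]
    with its closed form, and the trajectory of a node gives the entropy rate. *)
Lemma is_derive_entropy (c : R -> state) (t : R) (dc : state) :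
  admissible gamma (c t) ->
  (forall k, is_derive t 1 (fun s => c s k 0) (dc k 0)) ->
  is_derive t 1 (fun s => entropy gamma (c s))
    (dot (euler_entropy_var (c t)) dc).
Proof.
move=> [r_gt0 P_gt0] Dc.
have r2_neq0 : 2 * density (c t) != 0 by rewrite mulf_neq0 ?gt_eqF.
have Dr : is_derive t 1 (fun s => density (c s)) (dc 0 0) := Dc 0.
have Dm := is_deriveD (is_deriveD (is_deriveX 2 (Dc 1)) (is_deriveX 2 (Dc 2)))
  (is_deriveX 2 (Dc 3)).
have DV := @is_deriveV _ (fun s => 2 * density (c s)) _ _ _ r2_neq0
  (is_deriveZ 2 Dr).
have DP := is_deriveZ (gamma - 1) (is_deriveB (Dc 4) (is_deriveM Dm DV)).
have DlnP := @is_derive1_comp _ (@ln R) (fun s => pressure gamma (c s)) _ _ _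
  (is_derive1_ln P_gt0) DP.
have Dlnr := @is_derive1_comp _ (@ln R) (fun s => density (c s)) _ _ _
  (is_derive1_ln r_gt0) Dr.
have Dn := is_deriveZ (- (gamma - 1)^-1)
  (is_deriveM Dr (is_deriveB DlnP (is_deriveZ gamma Dlnr))).
rewrite (_ : (fun s => _) = (- (gamma - 1)^-1 \*: ((fun s => density (c s)) *
  (((@ln R) \o (fun s => pressure gamma (c s)))
   - gamma \*: ((@ln R) \o (fun s => density (c s))))))); last first.
  by apply/funext => s; rewrite /entropy mulNr mulrC -mulNr.
apply: is_derive_eq Dn _.
rewrite dotE sum_ord5 !vec5E !fctE /= /spec_entropy /beta /speed2 /ux /uy /uz.
rewrite /GRing.scale /= -/(mx (c t)) -/(my (c t)) -/(mz (c t)).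
move: (pressure gamma (c t)) (density (c t)) P_gt0 r_gt0 => P r P_gt0 r_gt0.
by field; rewrite ?gt_eqF //= ?subr_gt0 ?mulr_gt0.
Qed.

Lemma entropy_varE U : admissible gamma U ->
  entropy_var gamma U = euler_entropy_var U.
Proof.
move=> admU; apply/colP => k; rewrite mxE.
pose c (h : R) : state := h *: delta_mx k 0 + U.
have c0 : c 0 = U by rewrite /c scale0r add0r.
have Dc (k' : 'I_5) : is_derive (0 : R) 1 (fun h => c h k' 0)
    ((delta_mx k 0 : state) k' 0).
  rewrite (_ : (fun h => _) = (delta_mx k 0 : state) k' 0 \*: id + cst (U k' 0)).
    by apply: is_derive_eq; rewrite addr0 /GRing.scale /= mulr1.
  by apply/funext => h; rewrite !mxE mulrC.
have := @is_derive_entropy c 0 (delta_mx k 0); rewrite c0 => /(_ admU Dc).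
case=> _; rewrite dotE (bigD1 k) //= big1 => [|k' neq_k'k]; last first.
  by rewrite [delta_mx _ _ _ _]mxE (negPf neq_k'k) mulr0.
rewrite [delta_mx _ _ _ _]mxE !eqxx mulr1 addr0 => <-.
rewrite /derive; set F := fun h => _; set G := fun h => _.
suff -> : F = G by [].
by apply/funext => h; rewrite /F /G /= c0 addr0 [h *: 1]mulr1.
Qed.

(** Expresses the entropy through the logarithms of [density] and [beta], the two quantities whose
    logarithmic means enter the two-point flux. *)
Lemma spec_entropyE U : admissible gamma U ->
  spec_entropy gamma U =
  - (gamma - 1) * ln (density U) - ln (beta gamma U) - ln 2.
Proof.
move=> [r_gt0 P_gt0]; have P2_gt0 : 0 < 2 * pressure gamma U by exact: mulr_gt0.
by rewrite /spec_entropy /beta ln_div ?posrE // lnM ?posrE //; ring.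
Qed.

Lemma beta_gt0 U : admissible gamma U -> 0 < beta gamma U.
Proof. by move=> [r_gt0 P_gt0]; apply: divr_gt0 => //; exact: mulr_gt0. Qed.

Lemma momE d U : density U != 0 -> mom d U = density U * vel d U.
Proof. by move=> r_neq0; case: d; rewrite mulrC divfK. Qed.

Lemma energyE U : energy U = pressure gamma U / (gamma - 1)
  + (mx U ^+ 2 + my U ^+ 2 + mz U ^+ 2) / (2 * density U).
Proof. by rewrite /pressure mulrAC divff ?gt_eqF ?subr_gt0 // mul1r subrK. Qed.

Lemma entropy_potE d U : admissible gamma U -> entropy_pot gamma d U = mom d U.
Proof.
move=> admU; have [r_gt0 P_gt0] := admU.
have r_neq0 := lt0r_neq0 r_gt0.
rewrite /entropy_pot entropy_varE // dot_vec5 !vec5E /entropy_flux /entropy.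
rewrite energyE momE // /beta /speed2 /ux /uy /uz.
case: d => /=; rewrite /ux /uy; move: (pressure gamma U) (density U) P_gt0 r_gt0;
  move=> P r P_gt0 r_gt0; by field; rewrite ?gt_eqF //= ?subr_gt0 ?mulr_gt0.
Qed.

Lemma logmean_neq0 a b : 0 < a -> 0 < b -> logmean a b != 0.
Proof.
move=> a_gt0 b_gt0; rewrite /logmean; have [_|neq_ab] := eqVneq a b.
  exact: lt0r_neq0.
rewrite mulf_neq0 ?invr_neq0 ?subr_eq0 1?eq_sym //.
by rewrite (inj_in_eq (@ln_inj R)) ?posrE.
Qed.

(** Eliminates one logarithm rationally, the case of equal arguments included. *)
Lemma ln_logmean a b : 0 < a -> 0 < b -> ln b = ln a + (b - a) / logmean a b.
Proof.
move=> a_gt0 b_gt0; rewrite /logmean; have [->|neq_ab] := eqVneq a b.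
  by rewrite subrr mul0r addr0.
by rewrite invfM invrK mulrA divff ?mul1r ?subrKC // subr_eq0 eq_sym.
Qed.

Lemma logmeanC a b : logmean a b = logmean b a.
Proof.
rewrite /logmean eq_sym; have [//|_] := eqVneq b a.
by rewrite -[in RHS]opprB -[ln a - _]opprB invrN mulrNN.
Qed.

Lemma avgC a b : avg a b = avg b a. Proof. by rewrite /avg addrC. Qed.

Lemma avgxx a : avg a a = a.
Proof. by rewrite /avg; field. Qed.

Lemma logmeanxx a : logmean a a = a. Proof. by rewrite /logmean eqxx. Qed.

Lemma flux_ecC d L W : flux_ec gamma d L W = flux_ec gamma d W L.
Proof.
rewrite /flux_ec (logmeanC (density L)) (logmeanC (beta gamma L)).
rewrite (avgC (density L)) (avgC (beta gamma L)) (avgC (speed2 L)).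
by rewrite (avgC (ux L)) (avgC (uy L)) (avgC (uz L)) (avgC (vel d L)).
Qed.

Lemma flux_ecxx d U : admissible gamma U -> flux_ec gamma d U U = flux gamma d U.
Proof.
move=> [r_gt0 P_gt0]; rewrite /flux_ec !avgxx !logmeanxx /flux momE ?gt_eqF //.
rewrite energyE /beta /speed2 /ux /uy /uz.
case: d => /=; rewrite /ux /uy; move: (pressure gamma U) (density U) P_gt0 r_gt0;
  move=> P r P_gt0 r_gt0; congr vec5;
  by field; rewrite ?gt_eqF //= ?subr_gt0 ?mulr_gt0.
Qed.

(** The potential is the momentum by [entropy_potE]. Once [ln_logmean] replaces the logarithms at
    [W], those at [L] cancel, and a rational identity remains in which the logarithmic means are
    arbitrary nonzero numbers. *)
Lemma flux_ec_tadmor d L W : admissible gamma L -> admissible gamma W ->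
  dot (entropy_var gamma W - entropy_var gamma L) (flux_ec gamma d L W)
  = entropy_pot gamma d W - entropy_pot gamma d L.
Proof.
move=> admL admW; have [[rL _] [rW _]] := (admL, admW).
rewrite !entropy_potE // !momE ?gt_eqF // !entropy_varE // dotBl !dot_vec5 !vec5E.
rewrite !spec_entropyE //.
have bL := beta_gt0 admL; have bW := beta_gt0 admW.
rewrite (ln_logmean rL rW) (ln_logmean bL bW) /avg /speed2.
have := logmean_neq0 rL rW; have := logmean_neq0 bL bW.
move: (logmean _ _) (logmean _ _) => bl rl bl_neq0 rl_neq0.
move: (beta gamma L) (beta gamma W) bL bW => b1 b2 b1_gt0 b2_gt0.
by case: d => /=; field; rewrite ?bl_neq0 ?rl_neq0 ?gt_eqF ?subr_gt0 ?addr_gt0.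
Qed.

End EulerEntropy.

(** * Balance over the mesh *)

Section PeriodicMesh.
Context {R : realType} (T : mesh R).
Implicit Types K L : T.

Lemma elt_in_domain K :
  [/\ xmin T <= xlo K, xhi K <= xmax T, ymin T <= ylo K & yhi K <= ymax T].
Proof.
have [ltx lty] := elt_nondeg K.
have mem x y : xlo K <= x <= xhi K -> ylo K <= y <= yhi K ->
    xmin T <= x <= xmax T /\ ymin T <= y <= ymax T.
  move=> Kx Ky.
  suff : (`[xmin T, xmax T] `*` `[ymin T, ymax T]) (x, y).
    by case=> /=; rewrite !in_itv.
  by rewrite -(elt_cover T); exists K => //; split; rewrite /= in_itv.
have [||/andP[-> _] /andP[-> _]] := mem (xlo K) (ylo K).
- by rewrite lexx ltW.
- by rewrite lexx ltW.
have [||/andP[_ ->] /andP[_ ->]] // := mem (xhi K) (yhi K).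
- by rewrite lexx ltW.
- by rewrite lexx ltW.
Qed.

Lemma elt_eq_corner K L : xhi K = xhi L -> yhi K = yhi L -> K = L.
Proof.
move=> Ex Ey; have [//|/elt_disjoint disj] := eqVneq K L; exfalso.
have [[ltxK ltyK] [ltxL ltyL]] := (elt_nondeg K, elt_nondeg L).
(* A point near the common upper right corner, lying in both interiors. *)
pose x := (Num.max (xlo K) (xlo L) + xhi K) / 2.
pose y := (Num.max (ylo K) (ylo L) + yhi K) / 2.
have max_mid (a b c : R) : a < c -> b < c ->
    a < (Num.max a b + c) / 2 < c /\ b < (Num.max a b + c) / 2 < c.
  by move=> ltac ltbc; case: (leP a b) => cmp; split; lra.
have [xK xL] : xlo K < x < xhi K /\ xlo L < x < xhi K.
  by apply: max_mid; rewrite // Ex.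
have [yK yL] : ylo K < y < yhi K /\ ylo L < y < yhi K.
  by apply: max_mid; rewrite // Ey.
suff : (@set0 (R * R)) (x, y) by [].
by rewrite -disj; split; split; rewrite /= in_itv //= -?Ex -?Ey.
Qed.

(** The element west of [east K] spans the same heights as [K], and both end at the left side of
    [east K] up to periodicity. Mixed cases of [glued] would make an element end at [xmin] or begin
    at [xmax], which containment in the domain and nondegeneracy forbid. *)
Lemma eastK : cancel (@east R T) (@west R T).
Proof.
move=> K; have [gK _ yE] := east_conforming K.
have [gL _ yL] := west_conforming (east K).
apply: elt_eq_corner; last by rewrite yL yE.
have [loK hiK _ _] := elt_in_domain K.
have [loL hiL _ _] := elt_in_domain (west (east K)).
have [[ltK _] [ltL _]] := (elt_nondeg K, elt_nondeg (west (east K))).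
by case: gK gL => [?|[? ?]] [?|[? ?]]; lra.
Qed.

Lemma northK : cancel (@north R T) (@south R T).
Proof.
move=> K; have [gK _ xE] := north_conforming K.
have [gL _ xL] := south_conforming (north K).
apply: elt_eq_corner; first by rewrite xL xE.
have [_ _ loK hiK] := elt_in_domain K.
have [_ _ loL hiL] := elt_in_domain (south (north K)).
have [[_ ltK] [_ ltL]] := (elt_nondeg K, elt_nondeg (south (north K))).
by case: gK gL => [?|[? ?]] [?|[? ?]]; lra.
Qed.

Lemma hy_east K : hy (east K) = hy K.
Proof. by rewrite /hy; case: (east_conforming K) => _ -> ->. Qed.

Lemma hx_north K : hx (north K) = hx K.
Proof. by rewrite /hx; case: (north_conforming K) => _ -> ->. Qed.

Lemma hx_ge0 K : 0 <= hx K.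
Proof. by have [lt_x _] := elt_nondeg K; rewrite subr_ge0 ltW. Qed.

Lemma hy_ge0 K : 0 <= hy K.
Proof. by have [_ lt_y] := elt_nondeg K; rewrite subr_ge0 ltW. Qed.

End PeriodicMesh.

Section LineBalance.
Context {R : realType} {p : nat}.
Variables (gamma : R) (xi : 'I_p.+1 -> R).
Hypotheses (gamma_gt1 : 1 < gamma) (p_gt0 : (0 < p)%N) (xi_gll : gll_nodes xi).
Implicit Types (d : direction) (u v : 'I_p.+1 -> @state R) (i r : 'I_p.+1).

Local Notation Q := (Qmat xi).

(** Against a symmetric [S], doubling [Q] amounts to adding its transpose, and summation by parts
    leaves the two corner entries. *)
Lemma Qmat_symmetric_sum (M : lmodType R) (S : 'I_p.+1 -> 'I_p.+1 -> M) :
  (forall i r, S i r = S r i) ->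
  2 *: \sum_i \sum_r Q i r *: S i r = S ord_max ord_max - S ord0 ord0.
Proof.
move=> symS; rewrite scaler_nat mulr2n [X in _ + X]exchange_big -big_split /=.
have sum_at a : \sum_i \sum_r ((i == a)%:R * (r == a)%:R) *: S i r = S a a.
  rewrite (bigD1 a) //= (bigD1 a) //= eqxx mulr1 scale1r !big1 ?addr0 //.
    move=> i /negPf->; apply: big1 => r _; by rewrite mul0r scale0r.
  by move=> r /negPf->; rewrite mulr0 scale0r.
rewrite -[X in X - _]sum_at -[X in _ - X]sum_at -sumrB.
apply: eq_bigr => i _; rewrite -big_split -sumrB; apply: eq_bigr => r _ /=.
by rewrite [S r i]symS -scalerDl -scalerBl (sum_by_parts p_gt0 xi_gll).
Qed.

(** The one-dimensional scheme on a grid line, stripped of metric and transverse weights; [Fl] and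
    [Fr] are the interface fluxes at its two ends. *)
Definition line_residual d u (Fl Fr : state) i : state :=
  2 *: \sum_r Q i r *: flux_ec gamma d (u i) (u r)
  + ((i == ord0)%:R *: (flux gamma d (u ord0) - Fl)
     - (i == ord_max)%:R *: (flux gamma d (u ord_max) - Fr)).

Lemma line_balance d u v (psi : 'I_p.+1 -> R) Fl Fr :
  (forall i, admissible gamma (u i)) ->
  (forall i r, dot (v i - v r) (flux_ec gamma d (u i) (u r)) = psi i - psi r) ->
  \sum_i dot (v i) (line_residual d u Fl Fr i) =
  (dot (v ord_max) Fr - psi ord_max) - (dot (v ord0) Fl - psi ord0).
Proof.
move=> adm_u shuffle.
have pick a (F : 'I_p.+1 -> state) :
    \sum_i dot (v i) ((i == a)%:R *: F a) = dot (v a) (F a).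
  rewrite (bigD1 a) //= eqxx scale1r big1 ?addr0 // => i /negPf->.
  by rewrite scale0r /dot mulmx0 mxE.
have vol : \sum_i dot (v i) (2 *: \sum_r Q i r *: flux_ec gamma d (u i) (u r)) =
    (dot (v ord_max) (flux gamma d (u ord_max)) - psi ord_max)
    - (dot (v ord0) (flux gamma d (u ord0)) - psi ord0).
  (* The hypothesis [shuffle] makes [v i] tested with the two-point flux equal to [S i r + psi i].
     By consistency of the flux, [S i i] is the tested physical flux minus [psi i]. *)
  pose S i r : R^o := dot (2^-1 *: (v i + v r)) (flux_ec gamma d (u i) (u r))
    - (psi i + psi r) / 2.
  have symS i r : S i r = S r i.
    by rewrite /S addrC [v i + _]addrC [psi i + _]addrC flux_ecC addrC.
  have Sii i : S i i = dot (v i) (flux gamma d (u i)) - psi i.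
    have -> : S i i = dot (2^-1 *: (2 *: v i)) (flux gamma d (u i)) - psi i.
      by rewrite /S flux_ecxx // scaler_nat mulr2n; congr (_ - _); field.
    by rewrite scalerA mulVf ?scale1r.
  have := Qmat_symmetric_sum symS; rewrite !Sii => <-.
  rewrite scaler_sumr; apply: eq_bigr => i _.
  rewrite dotZr dot_sumr [RHS]mulr_sumr mulr_sumr.
  (* The surplus [psi i] does not depend on [r], so vanishing row sums of [Q] allow inserting it. *)
  have -> : \sum_r 2 * (Q i r *: S i r) = \sum_r 2 * (Q i r *: S i r)
      + 2 * psi i * \sum_r Q i r.
    by rewrite (Qmat_row_sum p_gt0 xi_gll) mulr0 addr0.
  rewrite mulr_sumr -big_split; apply: eq_bigr => r _ /=.
  rewrite dotZr /S; have := shuffle i r; rewrite dotBl.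
  have -> : dot (2^-1 *: (v i + v r)) (flux_ec gamma d (u i) (u r)) =
    2^-1 * (dot (v i) (flux_ec gamma d (u i) (u r))
            + dot (v r) (flux_ec gamma d (u i) (u r))).
    by rewrite -dotDl /dot linearZ -scalemxAl mxE.
  rewrite /GRing.scale /=; move: (dot _ _) (dot _ _) => b a Eab.
  have -> : b = a - (psi i - psi r) by rewrite -Eab; ring.
  by field.
rewrite /line_residual; under eq_bigr do rewrite dotDr dotBr.
rewrite big_split sumrB /= vol.
rewrite (pick ord0 (fun _ => flux gamma d (u ord0) - Fl)).
rewrite (pick ord_max (fun _ => flux gamma d (u ord_max) - Fr)) !dotBr.
ring.
Qed.

End LineBalance.

Section GlobalBalance.
Context {R : realType} {p : nat} {T : mesh R}.
Variables (gamma : R) (xi : 'I_p.+1 -> R).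
Hypotheses (gamma_gt1 : 1 < gamma) (p_gt0 : (0 < p)%N) (xi_gll : gll_nodes xi).
Implicit Types (U v : @nodal_states R p T) (K : T) (i j : 'I_p.+1).

Local Notation w := (weight xi).
Local Notation residual U K i j :=
  (vol_residual gamma xi U K i j + surf_residual gamma xi U K i j).

Lemma residual_lines U K i j : residual U K i j =
  (hy K / 2 * w j) *: line_residual gamma xi dirX (fun r => U K r j)
    (iflux_x gamma U (west K) j) (iflux_x gamma U K j) i
  + (hx K / 2 * w i) *: line_residual gamma xi dirY (fun s => U K i s)
    (iflux_y gamma U (south K) i) (iflux_y gamma U K i) j.
Proof.
rewrite /line_residual (scalerDr (hy K / 2 * w j)) (scalerDr (hx K / 2 * w i)).
rewrite [RHS]addrACA; congr (_ + _).
  rewrite /vol_residual; congr (_ + _); rewrite [RHS]scalerA [_ * 2]mulrC;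
    rewrite -[RHS]scalerA scaler_sumr; congr (_ *: _); apply: eq_bigr => r _;
    by rewrite [RHS]scalerA [LHS]scalerA; congr (_ *: _); ring.
have scale_out (a b c h : R) (A B : @state R) :
    c *: (a *: (h *: A) - b *: (h *: B)) = (h * c) *: (a *: A - b *: B).
  by rewrite !scalerBr !scalerA; congr (_ *: _ - _ *: _); ring.
by rewrite /surf_residual addrC !scale_out.
Qed.

Lemma dot_residual U K i j V : dot V (residual U K i j) =
  hy K / 2 * w j * dot V (line_residual gamma xi dirX (fun r => U K r j)
    (iflux_x gamma U (west K) j) (iflux_x gamma U K j) i)
  + hx K / 2 * w i * dot V (line_residual gamma xi dirY (fun s => U K i s)
    (iflux_y gamma U (south K) i) (iflux_y gamma U K i) j).
Proof. by rewrite residual_lines dotDr; congr (_ + _); exact: dotZr. Qed.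

(* Conservation is the case of a constant test field [v] with [psi_x] and     *)
(* [psi_y] zero; the entropy balance takes for [v] the entropy variables and  *)
(* for [psi_x] and [psi_y] the entropy potentials.                            *)
Lemma global_balance U v (psi_x psi_y : T -> 'I_p.+1 -> 'I_p.+1 -> R) :
  (forall K i j, admissible gamma (U K i j)) ->
  (forall K i r j, dot (v K i j - v K r j)
     (flux_ec gamma dirX (U K i j) (U K r j)) = psi_x K i j - psi_x K r j) ->
  (forall K i j s, dot (v K i j - v K i s)
     (flux_ec gamma dirY (U K i j) (U K i s)) = psi_y K i j - psi_y K i s) ->
  \sum_K \sum_i \sum_j dot (v K i j) (residual U K i j) =
  - (\sum_K \sum_j hy K / 2 * w j *
       (dot (v (east K) ord0 j - v K ord_max j) (iflux_x gamma U K j)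
        - (psi_x (east K) ord0 j - psi_x K ord_max j))
     + \sum_K \sum_i hx K / 2 * w i *
       (dot (v (north K) i ord0 - v K i ord_max) (iflux_y gamma U K i)
        - (psi_y (north K) i ord0 - psi_y K i ord_max))).
Proof.
move=> adm shuffle_x shuffle_y.
under eq_bigr do under eq_bigr do under eq_bigr do
  rewrite dot_residual.
pose east_sum K := \sum_j hy K / 2 * w j *
  (dot (v K ord_max j) (iflux_x gamma U K j) - psi_x K ord_max j).
pose west_sum K := \sum_j hy K / 2 * w j *
  (dot (v K ord0 j) (iflux_x gamma U (west K) j) - psi_x K ord0 j).
pose north_sum K := \sum_i hx K / 2 * w i *
  (dot (v K i ord_max) (iflux_y gamma U K i) - psi_y K i ord_max).
pose south_sum K := \sum_i hx K / 2 * w i *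
  (dot (v K i ord0) (iflux_y gamma U (south K) i) - psi_y K i ord0).
(* Each element contributes the values at its upper ends minus those at its lower ends, line by
   line. *)
transitivity (\sum_K ((east_sum K - west_sum K) + (north_sum K - south_sum K))).
  apply: eq_bigr => K _.
  under eq_bigr do rewrite big_split.
  rewrite big_split; congr (_ + _).
    rewrite exchange_big -sumrB; apply: eq_bigr => j _.
    rewrite -mulr_sumr -mulrBr; congr (_ * _).
    apply: (line_balance gamma_gt1 p_gt0 xi_gll (v := fun i => v K i j)
      (psi := fun i => psi_x K i j)) => [i|i r]; first exact: adm.
    exact: shuffle_x.
  rewrite -sumrB; apply: eq_bigr => i _.
  rewrite -mulr_sumr -mulrBr; congr (_ * _).
  apply: (line_balance gamma_gt1 p_gt0 xi_gll (v := fun j => v K i j)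
    (psi := fun j => psi_y K i j)) => [j|j s]; first exact: adm.
  exact: shuffle_y.
rewrite big_split /= !sumrB.
(* Reindexing the lower-end sums by the neighbour puts both traces of a face next to the same
   interface flux. *)
rewrite [X in _ - X + _](reindex_inj (can_inj (@eastK _ T))).
rewrite [X in _ + (_ - X)](reindex_inj (can_inj (@northK _ T))).
rewrite opprD -!sumrB -!sumrN; congr (_ + _); apply: eq_bigr => K _;
  rewrite -sumrB -sumrN; apply: eq_bigr => i _.
- by rewrite eastK hy_east dotBl; ring.
- by rewrite northK hx_north dotBl; ring.
Qed.

End GlobalBalance.

Lemma is_derive_bigsum (R : realType) (V W : normedModType R) (I : Type)
    (r : seq I) (h : I -> V -> W) (dh : I -> W) (x v : V) :
  (forall i, is_derive x v (h i) (dh i)) ->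
  is_derive x v (fun y => \sum_(i <- r) h i y) (\sum_(i <- r) dh i).
Proof.
move=> Dh; elim: r => [|i r IH].
  rewrite big_nil (_ : (fun y => _) = cst 0); first exact: is_derive_cst.
  by apply/funext => y; rewrite big_nil.
rewrite big_cons (_ : (fun y => _) = h i + (fun y => \sum_(i <- r) h i y)).
  exact: is_deriveD.
by apply/funext => y; rewrite big_cons.
Qed.

Theorem theorem1 (R : realType) (gamma : R) (gamma_gt1 : 1 < gamma)
    (T : mesh R) (p : nat) (p_ge1 : (1 <= p)%N)
    (xi : 'I_p.+1 -> R) (xi_gll : gll_nodes xi)
    (I : set R) (I_itv : is_interval I) (I_open : open I)
    (U : R -> @nodal_states R p T)
    (U_sol : dgsem_solution gamma xi I U)
    (U_adm : forall t, I t -> forall K i j, admissible gamma (U t K i j)) :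
  (forall t, I t ->
     derivable (fun s => total_state xi (U s)) t 1 /\
     derive1 (fun s => total_state xi (U s)) t = 0) /\
  ((forall t, I t -> tadmor_at_interfaces gamma (U t)) ->
   forall t, I t ->
     derivable (fun s => total_entropy gamma xi (U s)) t 1 /\
     derive1 (fun s => total_entropy gamma xi (U s)) t <= 0).
Proof.
pose dU t K i j : @state R := derive1 (fun s => U s K i j) t.
have DU t K i j : I t -> is_derive t 1 (fun s => U s K i j) (dU t K i j).
  by move=> /U_sol/(_ K i j)[dU_t _]; rewrite /dU derive1E; exact: derivableP.
have ode t K i j : I t -> mass xi K i j *: dU t K i j =
    - (vol_residual gamma xi (U t) K i j + surf_residual gamma xi (U t) K i j).
  move=> /U_sol/(_ K i j)[_]; rewrite -addrA => /eqP.
  by rewrite addr_eq0 => /eqP.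
have rate t v : I t ->
    \sum_K \sum_i \sum_j dot (v K i j) (mass xi K i j *: dU t K i j) =
    - \sum_K \sum_i \sum_j dot (v K i j)
      (vol_residual gamma xi (U t) K i j + surf_residual gamma xi (U t) K i j).
  move=> It; rewrite -sumrN; apply: eq_bigr => K _; rewrite -sumrN.
  apply: eq_bigr => i _; rewrite -sumrN; apply: eq_bigr => j _.
  by rewrite ode // dotNr.
split=> [t It|tadm t It].
- have D : is_derive t 1 (fun s => total_state xi (U s))
      (\sum_K \sum_i \sum_j mass xi K i j *: dU t K i j).
    do 3!apply: is_derive_bigsum => ?; apply: is_deriveZ; exact: DU.
  split; first by case: D.
  (* Component [k] is the pairing with a constant basis vector, whose jumps all vanish. *)
  rewrite derive1E; case: D => _ ->; apply/colP => k; rewrite mxE -dot_delta.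
  rewrite dot_sumr; under eq_bigr do rewrite dot_sumr.
  under eq_bigr do under eq_bigr do rewrite dot_sumr.
  rewrite (rate t (fun _ _ _ => delta_mx k 0)) //.
  rewrite (global_balance gamma_gt1 p_ge1 xi_gll
    (psi_x := fun _ _ _ => 0) (psi_y := fun _ _ _ => 0)) //; last 3 first.
  + exact: U_adm.
  + by move=> *; rewrite dotBl !subrr.
  + by move=> *; rewrite dotBl !subrr.
  rewrite opprK !big1 ?addr0 // => K _; rewrite big1 // => i _;
    by rewrite dotBl !subrr mulr0.
- have D : is_derive t 1 (fun s => total_entropy gamma xi (U s))
      (\sum_K \sum_i \sum_j dot (entropy_var gamma (U t K i j))
        (mass xi K i j *: dU t K i j)).
    apply: is_derive_bigsum => K; apply: is_derive_bigsum => i.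
    apply: is_derive_bigsum => j; rewrite dotZr.
    apply: is_deriveZ; rewrite (entropy_varE gamma_gt1 (U_adm t It K i j)).
    apply: is_derive_entropy => [||k] //; first exact: U_adm.
    have [dU_t dUE] := DU t K i j It; rewrite -dUE derive_mx // mxE.
    apply/derivableP.
    by move/derivable_mxP: dU_t; exact.
  split; first by case: D.
  rewrite derive1E; case: D => _ ->; have [tad_x tad_y] := tadm t It.
  rewrite (rate t (fun K i j => entropy_var gamma (U t K i j))) //.
  rewrite (global_balance gamma_gt1 p_ge1 xi_gll
    (psi_x := fun K i j => entropy_pot gamma dirX (U t K i j))
    (psi_y := fun K i j => entropy_pot gamma dirY (U t K i j))); last 3 first.
  + exact: U_adm.
  (* Symmetry of the flux reconciles the difference taken here, first state minus second, with the
     opposite order in Tadmor's identity. *)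
  + by move=> K i r j; rewrite flux_ecC flux_ec_tadmor //; exact: U_adm.
  + by move=> K i j s; rewrite flux_ecC flux_ec_tadmor //; exact: U_adm.
  (* Each face node now contributes a nonnegative weight times the left side of Tadmor's
     inequality. *)
  rewrite opprK; have w_ge0 := weight_ge0 p_ge1 xi_gll.
  rewrite -[leRHS]addr0; apply: lerD; apply: sumr_le0 => K _;
    apply: sumr_le0 => i _; apply: mulr_ge0_le0.
  + by rewrite mulr_ge0 // divr_ge0 // hy_ge0.
  + exact: tad_x.
  + by rewrite mulr_ge0 // divr_ge0 // hx_ge0.
  + exact: tad_y.
Qed.
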